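(* Let $(X_n)_{n\ge 1}$ be a discretization system of $[0,1]$, with maximal resolutions $H_n$ and minimal resolutions $h_n$. For a typical $f\in C([0,1])$ the following holds: (i) (Qualitative) For any nonempty finite word $w$ over the alphabet $\{-1,0,1\}$ and any real $\alpha\in[0,\frac{1}{p(w)}]$, there exists a subsequence $(n_i)$ such that $\lim_{i\to\infty}\mathrm{fr}(w,q(f,n_i))=\alpha$. (ii) (Quantitative) Suppose that $\liminf_{n\to\infty} n h_n=0$. Then for any nonempty finite word $w$ over the alphabet $\mathbb{Z}$ and any real $\alpha\in[0,\frac{1}{p(w)}]$, there exists a subsequence $(n_i)$ such that $\lim_{i\to\infty}\mathrm{fr}(w,Q(f,n_i))=\alpha$. (iii) (Stretched) Suppose that $\liminf_{n\to\infty} n h_n=0$ and that the sequence $\frac{H_n}{h_n}$ is bounded. Then $$\liminf_{n\to\infty}\mathrm{fr}(0,s(f,n))=0;$$ if $f(1)\ge f(0)$, then $$\liminf_{n\to\infty}\mathrm{fr}(1,s(f,n))=\limsup_{n\to\infty}\mathrm{fr}(-1,s(f,n))=\frac12;$$ and if $f(1)\le f(0)$, then $$\limsup_{n\to\infty}\mathrm{fr}(1,s(f,n))=\liminf_{n\to\infty}\mathrm{fr}(-1,s(f,n))=\frac12.$$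
   Context: $C([0,1])$ is the space of continuous real-valued functions on $[0,1]$ with the sup norm. A property holds for a typical $f\in C([0,1])$ if the set of functions having it is residual, i.e. contains a dense $G_\delta$ subset of $C([0,1])$. In the theorem, the exceptional set depends only on the discretization system, not on $w$ or $\alpha$. A discretization system of $[0,1]$ is a sequence of finite sets $X_n=\{0=x^n_1,x^n_2,\dots,x^n_{N_n}=1\}\subset[0,1]$, $n\ge1$, such that $X_1\subset X_2\subset\cdots$, $x^n_i<x^n_{i+1}$ for all $1\le i<N_n$, and the maximal resolution $H_n:=\max_{1\le i<N_n}|x^n_{i+1}-x^n_i|$ converges to $0$. The minimal resolution is $h_n:=\min_{1\le i<N_n}|x^n_{i+1}-x^n_i|$. For $f\in C([0,1])$ and $1\le i\le N_n$, $f^n_i$ denotes the unique integer $j\in\mathbb{Z}$ such that $f(x^n_i)\in[jh_n,(j+1)h_n)$. Quantitative code: $Q(f,n)\in\mathbb{Z}^{N_n-1}$ is the word with letters $Q(f,n)_i:=f^n_{i+2}-f^n_{i+1}$, $0\le i<N_n-1$. Qualitative code: $q(f,n)\in\{-1,0,1\}^{N_n-1}$ is the word with $q(f,n)_i=1$ if $Q(f,n)_i>0$, $q(f,n)_i=0$ if $Q(f,n)_i=0$, and $q(f,n)_i=-1$ if $Q(f,n)_i<0$. Stretched code: $s(f,n)$ is the finite word over $\{-1,0,1\}$ obtained from $Q(f,n)$ by replacing each letter $Q(f,n)_i$ by: a run of $Q(f,n)_i$ letters $1$ followed by one letter $0$, if $Q(f,n)_i>0$; a run of $|Q(f,n)_i|$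 letters $-1$ followed by one letter $0$, if $Q(f,n)_i<0$; a single letter $0$, if $Q(f,n)_i=0$. For finite words $w,v$ over the same (finite or infinite) alphabet with $|w|\le|v|$ (where $|\cdot|$ is word length, and letters of $v$ are indexed from $0$), $\mathrm{oc}(w,v)$ is the number of $j$ with $0\le j\le|v|-|w|$ such that the factor of $v$ of length $|w|$ starting at position $j$ equals $w$ (overlapping occurrences are counted), and $\mathrm{fr}(w,v):=\mathrm{oc}(w,v)/|v|$. The minimal periodic factor length of $w$ is $p(w):=\min\{|u|:\mathrm{oc}(w,wu)=2\}$, where $u$ ranges over finite words and $wu$ is concatenation; e.g. $p(010)=2$. A frequency of a word $w$ in the code $Q(f,n)$ or $q(f,n)$ is considered for $n$ with $N_n-1\ge|w|$, which holds for all large $n$. *)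

(* Defs.v *)
From HB Require Import structures.
From mathcomp Require Import all_boot all_order all_algebra.
From mathcomp Require Import all_classical all_reals all_analysis borel_hierarchy.

Set Implicit Arguments.
Unset Strict Implicit.
Unset Printing Implicit Defensive.
Import Order.TTheory GRing.Theory Num.Theory numFieldNormedType.Exports.
Local Open Scope classical_set_scope.
Local Open Scope ring_scope.

Definition I01 (R : realType) := set_type (`[0, 1]%classic : set R).

Definition C01 (R : realType) := continuousType (I01 R) R.

(* Uniform convergence on [0,1]; [nbhs_C01P] below identifies this topology
   with that of the sup norm. *)
HB.instance Definition _ (R : realType) :=
  Uniform.copy (C01 R)
    (initial_topology (id : C01 R -> arrow_uniform_type (I01 R) R)).

Lemma zero_in01 (R : realType) : (0 : R) \in (`[0, 1]%classic : set R).
Proof. by rewrite inE /= in_itv /= lexx ler01. Qed.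

Lemma one_in01 (R : realType) : (1 : R) \in (`[0, 1]%classic : set R).
Proof. by rewrite inE /= in_itv /= lexx ler01. Qed.

Definition zero01 (R : realType) : I01 R := SigSub (zero_in01 R).
Definition one01 (R : realType) : I01 R := SigSub (one_in01 R).

Definition residual (T : topologicalType) (A : set T) : Prop :=
  exists2 G : set T, Gdelta G /\ dense G & G `<=` A.

Definition typical (R : realType) (P : C01 R -> Prop) : Prop :=
  residual [set f : C01 R | P f].

Section Words.
Variable A : eqType.
Implicit Types w v : seq A.

(* When [size v < size w] only the position [j = 0] is tested, and it fails,
   so that [oc w v = 0]. *)
Definition oc w v : nat :=
  count (fun j => take (size w) (drop j v) == w)
    (iota 0 (size v - size w).+1).

Definition fr (R : realType) w v : R := (oc w v)%:R / (size v)%:R.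

End Words.

Lemma period_subproof (w : seq int) :
  exists k, `[< exists2 u : seq int, size u = k & oc w (w ++ u) = 2%N >].
Proof.
case: w => [|a w0]; first by exists 1%N; apply/asboolP; exists [:: 0].
have : (0 < size (a :: w0))%N by [].
move: (a :: w0) => w w_gt0; pose P j := (0 < j)%N && (take (size w) (drop j (w ++ w)) == w).
have Pw : P (size w) by rewrite /P w_gt0 drop_size_cat // take_size eqxx.
have exP : exists j, P j by exists (size w).
case: (ex_minnP exP) => j /andP[j0 /eqP wj] jmin.
have jw : (j <= size w)%N by exact: jmin.
exists j; apply/asboolP; exists (take j w); first by rewrite size_takel.
have eqt : forall i, (i <= j)%N ->
    take (size w) (drop i (w ++ take j w)) = take (size w) (drop i (w ++ w)).
  move=> i ij.
  have -> : w ++ take j w = take (size w + j) (w ++ w).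
    by rewrite take_cat ltnNge leq_addr /= addKn.
  by rewrite !take_drop take_takel // leq_add2l.
rewrite /oc size_cat addKn size_takel //.
rewrite (eq_in_count (a2 := pred2 0%N j)); last first.
  move=> i; rewrite mem_iota add0n ltnS /= => ij; rewrite eqt //.
  have [->|i0] := eqVneq i 0%N; first by rewrite drop0 take_size_cat // eqxx.
  have [->|nij] := eqVneq i j; first by rewrite wj eqxx.
  apply/negbTE/negP => /eqP wi.
  have : P i by rewrite /P lt0n i0 wi eqxx.
  by move=> /jmin; rewrite leqNgt ltn_neqAle nij ij.
have -> : count (pred2 0%N j) (iota 0 j.+1) =
    (count_mem 0%N (iota 0 j.+1) + count_mem j (iota 0 j.+1))%N.
  rewrite -count_predUI [count (predI _ _) _](_ : _ = 0%N) ?addn0.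
    exact: eq_count.
  apply/eqP; rewrite -leqn0 leqNgt -has_count; apply/hasPn => i _ /=.
  by apply/negP => /andP[/eqP -> /eqP j0']; rewrite -j0' in j0.
by rewrite !count_uniq_mem ?iota_uniq // !mem_iota !add0n /= ltnSn.
Qed.

(* The minimum does not change if [u] is restricted to an alphabet containing
   the letters of [w] (for instance {-1,0,1}): if |u| is minimal then [w] is a
   suffix of [w ++ u] and |u| <= |w|, so that [u] is a suffix of [w]. *)
Definition period (w : seq int) : nat := ex_minn (period_subproof w).

Lemma periodP (w : seq int) :
  (exists2 u : seq int, size u = period w & oc w (w ++ u) = 2%N) /\
  (forall u : seq int, oc w (w ++ u) = 2%N -> (period w <= size u)%N).
Proof.
rewrite /period; case: ex_minnP => k /asboolP uk kmin; split=> // u wu.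
by apply: kmin; apply/asboolP; exists u.
Qed.

Section Discretization.
Variable R : realType.

(* Sequences are indexed from 0: [X n] is the grid X_{n+1}, listed in increasing
   order, and [point n i] is its point x^{n+1}_{i+1}; likewise [maxres n] and
   [minres n] are H_{n+1} and h_{n+1}. *)
Section Grid.
Variable X : nat -> seq (I01 R).

Definition gridsize n : nat := size (X n).

Definition point n i : I01 R := nth (zero01 R) (X n) i.

Definition gap n i : R := `|\val (point n i.+1) - \val (point n i)|.

Definition maxres n : R := \big[Num.max/0]_(i < (gridsize n).-1) gap n i.

(* The gaps lie in ]0,1], so the default value 1 does not affect the minimum. *)
Definition minres n : R := \big[Num.min/1]_(i < (gridsize n).-1) gap n i.

Record discretization_system : Prop := DiscretizationSystem {
  grid_first : forall n, head (one01 R) (X n) = zero01 R;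
  grid_last : forall n, last (zero01 R) (X n) = one01 R;
  grid_sorted : forall n, sorted <%R [seq \val x | x <- X n];
  grid_nested : forall n, {subset X n <= X n.+1};
  grid_fine : maxres @ \oo --> (0 : R)
}.

(* The unique j with f(x) in [j h, (j+1) h[ for h = [minres n]: see [levelP]. *)
Definition level (f : C01 R) n i : int := Num.floor (f (point n i) / minres n).

Definition quant (f : C01 R) n : seq int :=
  mkseq (fun i => level f n i.+1 - level f n i) (gridsize n).-1.

Definition qual (f : C01 R) n : seq int := [seq sgz z | z <- quant f n].

Definition stretch (z : int) : seq int := rcons (nseq `|z|%N (sgz z)) 0.

Definition stretched (f : C01 R) n : seq int :=
  flatten [seq stretch z | z <- quant f n].

Lemma minres_gt0 n : discretization_system -> 0 < minres n.
Proof.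
move=> dX; rewrite /minres; elim/big_ind: _ => //.
  by move=> x y x0 y0; rewrite lt_min x0.
move=> i _; rewrite /gap normr_gt0 subr_eq0 gt_eqF //.
have iX : (i.+1 < size (X n))%N.
  by rewrite -ltn_predRL; exact: ltn_ord.
have /(sortedP 0)/(_ i) := grid_sorted dX n; rewrite size_map => /(_ iX).
by rewrite !(nth_map (zero01 R)) // ltnW.
Qed.

Lemma levelP (f : C01 R) n i (j : int) : discretization_system ->
  level f n i = j <->
  j%:~R * minres n <= f (point n i) < (j + 1)%:~R * minres n.
Proof.
move=> /(minres_gt0 n) h0; rewrite /level.
rewrite -ler_pdivlMr // -ltr_pdivrMr //; split=> [<-|].
  by rewrite floor_le floorD1_gt.
by move/floor_def.
Qed.

End Grid.

Definition sup_norm (g : I01 R -> R) : R := sup [set `|g x| | x in setT].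

Lemma nbhs_C01P (f : C01 R) (U : set (C01 R)) :
  nbhs f U <->
  exists2 e : R, 0 < e &
    forall g : C01 R, sup_norm (fun x => f x - g x) < e -> U g.
Proof.
have sup_ge (k : C01 R) : has_ubound [set `|f x - k x| | x in setT].
  have cd : continuous (fun x : I01 R => f x - k x).
    move=> x.
    exact: (@cvgB R R^o (I01 R) _ (nbhs_filter x) f k _ _ (cts_fun x) (cts_fun x)).
  have : {within `[0, 1], continuous (valL_ (0 : R) (fun x : I01 R => f x - k x))}.
    exact/subspace_valL_continuousP'.
  move=> /continuous_compact/(_ (@segment_compact R 0 1))/compact_bounded.
  move=> [M [_ /(_ (M + 1))]]; rewrite ltrDl ltr01 => /(_ isT) fkM.
  exists (M + 1) => _ [x _ <-]; apply: fkM; exists (\val x).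
    by apply/set_mem; exact: (valP x).
  exact: (congr1 (fun h => h x)
    (valLK (0 : R) (fun x : I01 R => f x - k x))).
rewrite -nbhs_entourageE; split.
- move=> [E [E' [/= B entB BE'] E'E] EU].
  move: entB; rewrite -entourage_ballE => -[e /= e0 eB].
  exists e => // g fge; apply/EU/mem_set/E'E/BE' => /= t; apply: eB => /=.
  rewrite /ball /=; apply: le_lt_trans fge.
  by apply: ub_le_sup => //; exists t.
- move=> [e e0 eU].
  exists [set fg : C01 R * C01 R | forall t, ball (fg.1 t) (e / 2) (fg.2 t)].
    exists [set fg | forall t : I01 R, ball (fg.1 t) (e / 2) (fg.2 t)] => //.
    exists [set xy : R * R | ball xy.1 (e / 2) xy.2] => //.
    by rewrite -entourage_ballE; exists (e / 2) => //=; rewrite divr_gt0.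
  move=> g /set_mem /= fg; apply: eU; rewrite /sup_norm.
  apply: (@le_lt_trans _ _ (e / 2)); last by rewrite ltr_pdivrMr // ltr_pMr // ltr1n.
  apply: ge_sup; first by exists `|f (zero01 R) - g (zero01 R)|, (zero01 R).
  by move=> _ [x _ <-]; exact: ltW (fg x).
Qed.

End Discretization.

(* Main.v *)
From HB Require Import structures.
Require Import Defs.
From mathcomp Require Import all_boot all_order all_algebra.
From mathcomp Require Import all_classical all_reals all_analysis.
From mathcomp Require Import zify ring lra.
Set Implicit Arguments.
Unset Strict Implicit.
Unset Printing Implicit Defensive.
Import Order.TTheory GRing.Theory Num.Theory numFieldNormedType.Exports.
Local Open Scope classical_set_scope.
Local Open Scope ring_scope.

(** The codes at scale [n] depend only on the values of [f] on a finite grid, and on each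
    value only through the interval of length [minres n] that contains it.  Putting the
    values at the centres of such intervals makes the codes constant on a ball around [f].
    By the Baire property of C([0,1]) ([C01_baire]) it is therefore enough to find,
    near every [g] and at arbitrarily large scales, one function whose code contains
    [w] with nearly the prescribed frequency ([exists_code]); countably many words
    and frequencies suffice ([generic_codes]).

    The code is modelled on a word that begins periodically, with a period at most
    [period w] at whose multiples [w] occurs, and ends with a constant filler
    in which [w] does not occur.  Lengthening the periodic part by one letter changes the number
    of occurrences by at most the length of [w], so every frequency between 0 and
    1 / [period w] is nearly attained ([exists_pattern]).  A function with
    exactly this code would drift away from [g].  So the values are reset to those of [g]
    every [T] grid points: this spoils a proportion of order 1 / [T] of the
    occurrences, and for [T] fixed and [n] large, both the drift between two resets and
    the oscillation of [g] between them are small.  The required values at the grid points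
    differ little from those of [g], and [C01_prescribe] extends them to a
    continuous function close to [g].  Since the sign word of the model of a word over
    {-1, 0, 1} is the model itself, the same function settles the qualitative code.

    For the stretched code, let V_n be the variation of [f] along the n-th grid.  The
    length of the code times [minres n] is at least V_n, whereas the number of letters 0
    times [minres n] is at most 1, and the difference between the numbers of letters 1 and
    -1 times [minres n] is at most |f(1) - f(0)| + 1.  Hence, as soon as V_n tends to
    infinity, the frequencies of 0, 1 and -1 converge to 0, 1/2 and 1/2.  The grids
    being nested, V_n is nondecreasing ([grid_variation_le]); it is unbounded because
    the one-letter word [k] has frequency near 1 in some quantitative codes,
    for every [k], and bounded ratios H_n / h_n make the number of gaps comparable to 1 / h_n
    ([grid_variation_unbounded]). *)

(** * Occurrences of a word in patterns *)

Definition mismatches (v v' : seq int) : nat :=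
  (\sum_(0 <= i < size v) (v`_i != v'`_i)%R)%N.

Lemma factor_nth (w v : seq int) j : (j + size w <= size v)%N ->
  (take (size w) (drop j v) == w)
    = all (fun r => v`_(j + r)%N == w`_r) (iota 0 (size w)).
Proof.
move=> jwv; have sz : size (take (size w) (drop j v)) = size w.
  by rewrite size_takel // size_drop; lia.
apply/eqP/allP => [eqw r|eqw].
  rewrite mem_iota add0n => /andP[_ rw].
  by rewrite -[in X in _ == X]eqw nth_take // nth_drop.
apply: (@eq_from_nth _ 0) => // r; rewrite sz => rw.
rewrite nth_take // nth_drop; apply/eqP/eqw.
by rewrite mem_iota.
Qed.

Lemma oc_short (w v : seq int) : (size v < size w)%N -> oc w v = 0%N.
Proof.
move=> vw; rewrite /oc (_ : (size v - size w)%N = 0%N) /=; last by lia.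
case: eqP => //= /(congr1 size); rewrite drop0 size_take => eqs.
by move: eqs; case: ifP; lia.
Qed.

Lemma ocE (w v : seq int) : (size w <= size v)%N ->
  oc w v = (\sum_(0 <= j < (size v - size w).+1)
     all (fun r => v`_(j + r)%N == w`_r)%R (iota 0 (size w)))%N.
Proof.
move=> wv; rewrite /oc -sum1_count big_mkcond /index_iota subn0.
rewrite big_seq [RHS]big_seq; apply: eq_bigr => j; rewrite mem_iota => /andP[_ jk].
rewrite factor_nth; first by case: all.
by rewrite addnC -leq_subRL.
Qed.

(** Each position where two words of equal length differ lies in at most [size w]
    windows of length [size w], hence spoils at most that many occurrences. *)
Lemma oc_mismatches (w v v' : seq int) : size v = size v' ->
  (oc w v <= oc w v' + size w * mismatches v v')%N.
Proof.
move=> vv'; have [vw|wv] := ltnP (size v) (size w); first by rewrite oc_short.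
rewrite !ocE -?vv' //; set K := (size v - size w).+1.
pose d i : nat := v`_i != v'`_i.
apply: (@leq_trans (\sum_(0 <= j < K)
  (all (fun r => v'`_(j + r)%N == w`_r)%R (iota 0 (size w))
    + \sum_(0 <= r < size w) d (j + r)))%N).
  apply: leq_sum => j _; have [/hasP[r]|/hasPn nd] :=
    boolP (has (fun r => v`_(j + r)%N != v'`_(j + r)%N) (iota 0 (size w))).
    move=> rw dr; apply: (leq_trans (leq_b1 _)); apply: (leq_trans _ (leq_addl _ _)).
    rewrite /index_iota subn0 (big_rem r rw) /= /d dr //.
  apply: (leq_trans _ (leq_addr _ _)).
  rewrite (eq_in_all (a2 := fun r => v'`_(j + r)%N == w`_r)) //.
  by move=> r /nd; rewrite negbK => /eqP ->.
rewrite big_split leq_add2l /= exchange_big_nat /=.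
rewrite -[X in (X * _)%N]subn0 -sum_nat_const_nat.
rewrite big_nat [leqRHS]big_nat; apply: leq_sum => r /andP[_ rw].
have -> : (\sum_(0 <= j < K) d (j + r) = \sum_(r <= i < K + r) d i)%N.
  by rewrite -{2}[r]add0n big_addn addnK.
rewrite /mismatches.
have Kr : (K + r <= size v)%N by rewrite /K; lia.
rewrite [leqRHS](@big_cat_nat _ _ _ (K + r)) //= -/d.
rewrite [in leqRHS](@big_cat_nat _ _ _ r) //=; last by rewrite /K; lia.
by rewrite (leq_trans (leq_addl _ _) (leq_addr _ _)).
Qed.

Lemma mismatchesC (v v' : seq int) :
  size v = size v' -> mismatches v v' = mismatches v' v.
Proof.
by move=> vv'; rewrite /mismatches vv'; apply: eq_bigr => i _; rewrite eq_sym.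
Qed.

(** A second occurrence of [w] in [w ++ u], shifted by [j], lets each letter of [w] be
    pulled back by [j], so that [w] is a prefix of a [j]-periodic word. *)
Lemma self_overlap (w : seq int) : exists2 j : nat,
  (0 < j <= period w)%N & forall i, (i < size w)%N -> w`_(i %% j)%N = w`_i.
Proof.
have [[u szu oc2] _] := periodP w.
have [j /andP[j0 jp] wj] : exists2 j : nat, (0 < j <= period w)%N &
    take (size w) (drop j (w ++ u)) == w.
  move: oc2; rewrite /oc size_cat addKn szu /= drop0 take_size_cat // eqxx add1n => -[].
  case: (boolP (has (fun j => take (size w) (drop j (w ++ u)) == w) (iota 1 (period w)))).
    by move=> /hasP[j]; rewrite mem_iota add1n ltnS => jp wj _; exists j.
  by rewrite has_count -leqNgt leqn0 => /eqP ->.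
have per i : (i < size w)%N -> (i >= j)%N -> w`_i = w`_(i - j)%N.
  move=> iw ji; move: wj; rewrite factor_nth ?size_cat ?szu 1?addnC ?leq_add2l // => /allP.
  move=> /(_ (i - j)%N); rewrite mem_iota add0n leq0n /= => /(_ ltac:(lia)) /eqP.
  by rewrite subnKC // nth_cat iw.
exists j; first by rewrite j0.
move=> i; elim/ltn_ind: i => i IH iw; have [ij|ji] := ltnP i j; first by rewrite modn_small.
rewrite (per i iw ji) -(IH (i - j)%N); [by rewrite -{1}(subnK ji) modnDr | lia | lia].
Qed.

(** A letter whose repetition avoids every nonempty [w], as it differs from some letter of [w]. *)
Definition filler (w : seq int) : int := (all (eq_op^~ 0) w)%:Z.

(** A [j]-periodic beginning of length [M] followed by [filler w].  When [size w < j] the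
    default value 0 of [nth] pads the period, which keeps the letters among 0 and
    those of [w]. *)
Definition pattern (w : seq int) j M i : int :=
  if (i < M)%N then w`_(i %% j)%N else filler w.

Lemma oc_filler (w : seq int) j N : w <> [::] -> oc w (mkseq (pattern w j 0) N) = 0%N.
Proof.
move=> w0; have [Nw|wN] := ltnP N (size w); first by rewrite oc_short // size_mkseq.
rewrite ocE ?size_mkseq //.
have [r rw wr] : exists2 r, (r < size w)%N & w`_r != filler w.
  rewrite /filler; have [aw|/allPn[x xw x0]] := boolP (all _ w).
    by exists 0%N; [case: (w) w0|case: (w) w0 aw => //= x s _ /andP[/eqP -> _]].
  by exists (index x w); rewrite ?index_mem // nth_index.
rewrite big_nat; apply: big1 => k /andP[_ kN].
apply/eqP; rewrite eqb0; apply/allPn; exists r; first by rewrite mem_iota.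
by rewrite nth_mkseq 1?eq_sym //; lia.
Qed.

(** By periodicity, [w] occurs at every multiple of [j] that leaves room for it. *)
Lemma oc_periodic (w : seq int) j N : (0 < j)%N -> (size w <= N)%N ->
  (forall i, (i < size w)%N -> w`_(i %% j)%N = w`_i) ->
  ((N - size w) %/ j <= oc w (mkseq (pattern w j N) N))%N.
Proof.
move=> j0 wN per; rewrite ocE ?size_mkseq // divn_count_dvd.
rewrite [leqRHS]big_ltn // -[leqLHS]add0n leq_add //.
rewrite big_nat [leqRHS]big_nat; apply: leq_sum => k /andP[k0 kN].
have [jk|] := boolP (j %| k)%N => //=.
rewrite lt0b; apply/allP => r; rewrite mem_iota add0n => /andP[_ rw].
rewrite nth_mkseq; last by lia.
rewrite /pattern ifT; last by lia.
by rewrite -modnDml (eqP jk) add0n per.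
Qed.

Lemma mismatches_pattern (w : seq int) j M N :
  (mismatches (mkseq (pattern w j M) N) (mkseq (pattern w j M.+1) N) <= 1)%N.
Proof.
rewrite /mismatches size_mkseq.
apply: (@leq_trans (\sum_(0 <= i < N | i == M) 1)%N); last first.
  by rewrite big_nat1_eq; case: ifP.
rewrite [leqRHS]big_mkcond big_nat [leqRHS]big_nat.
apply: leq_sum => i /andP[_ iN].
rewrite !nth_mkseq // /pattern ltnS [(i <= M)%N]leq_eqVlt.
by case: (i == M) => /=; [exact: leq_b1 | rewrite eqxx].
Qed.

(** Lengthening the periodic part of [pattern w j M] by one letter changes the
    number of occurrences of [w] by at most [size w]; it grows from 0 to about
    [N / j], so it comes close to every prescribed value in between. *)
Lemma exists_pattern (R : realType) (w : seq int) j N (a : R) :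
  w <> [::] -> (0 < j)%N -> (size w <= N)%N ->
  (forall i, (i < size w)%N -> w`_(i %% j)%N = w`_i) ->
  0 <= a <= N%:R / j%:R ->
  exists M, `|(oc w (mkseq (pattern w j M) N))%:R - a| <= (2 * size w).+1%:R.
Proof.
move=> w0 j0 wN per /andP[a0 aN].
pose g M := oc w (mkseq (pattern w j M) N).
have g0 : g 0%N = 0%N by exact: oc_filler.
have gS M : (g M <= g M.+1 + size w)%N /\ (g M.+1 <= g M + size w)%N.
  have := mismatches_pattern w j M N.
  set v := mkseq _ _; set v' := mkseq _ _ => vv1.
  have szv : size v = size v' by rewrite !size_mkseq.
  have := oc_mismatches w szv; have := oc_mismatches w (esym szv).
  rewrite (mismatchesC (esym szv)) -/(g M) -/(g M.+1); nia.
have gN : N%:R / j%:R <= (g N)%:R + (size w)%:R + 1 :> R.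
  have := oc_periodic j0 wN per; rewrite -/(g N) => gN.
  rewrite ler_pdivrMr ?ltr0n //.
  suff : (N <= (g N + size w + 1) * j)%N by rewrite -(ler_nat R) natrM !natrD.
  have := divn_eq (N - size w) j; have := ltn_pmod (N - size w) j0; nia.
(* The first M whose count reaches a - size w - 1. *)
have exM : exists M, a - (size w)%:R - 1 <= (g M)%:R by exists N; lra.
case: (ex_minnP exM) => M gM minM; exists M; rewrite -/(g M).
have w1 : 1 <= (size w)%:R :> R by rewrite ler1n; case: (w) w0.
have -> : (2 * size w).+1%:R = 2 * (size w)%:R + 1 :> R by rewrite -natr1 natrM.
rewrite ler_norml; apply/andP; split; first by lra.
case: M minM gM => [_ _|M minM gM]; first by rewrite g0; lra.
have : ~~ (a - (size w)%:R - 1 <= (g M)%:R).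
  by apply/negP => /minM; rewrite ltnn.
rewrite -ltNge => gMa.
have : (g M.+1)%:R <= (g M)%:R + (size w)%:R :> R.
  by rewrite -natrD ler_nat; case: (gS M).
lra.
Qed.

(** * Grids and levels *)

Section Geometry.
Variables (R : realType) (X : nat -> seq (I01 R)).
Hypothesis dX : discretization_system X.
Implicit Types (f g : C01 R) (n i k : nat).

Let N n := (gridsize X n).-1.

Lemma gridsize_gt1 n : (1 < gridsize X n)%N.
Proof.
rewrite /gridsize; move: (grid_first dX n) (grid_last dX n).
case: (X n) => [/= /(congr1 val)/= /eqP|x [|y s]] //=; first by rewrite oner_eq0.
by move=> -> /(congr1 val)/= /eqP; rewrite eq_sym oner_eq0.
Qed.

Lemma point_first n : Defs.point X n 0 = zero01 R.
Proof.
rewrite /Defs.point nth0 -(grid_first dX n).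
by case: (X n) (gridsize_gt1 n); rewrite /gridsize.
Qed.

Lemma point_last n : Defs.point X n (N n) = one01 R.
Proof. by rewrite /Defs.point /N /gridsize nth_last (grid_last dX). Qed.

Lemma mem_point n i : (i <= N n)%N -> Defs.point X n i \in X n.
Proof.
by move=> iN; rewrite mem_nth // -/(gridsize X n); move: (gridsize_gt1 n) iN; rewrite /N; lia.
Qed.

Lemma gapE n i : (i < N n)%N ->
  gap X n i = \val (Defs.point X n i.+1) - \val (Defs.point X n i).
Proof.
move=> iN; rewrite /gap gtr0_norm // subr_gt0.
have iX : (i.+1 < size (X n))%N by rewrite -/(gridsize X n); move: iN; rewrite /N; lia.
have /(sortedP 0)/(_ i) := grid_sorted dX n; rewrite size_map => /(_ iX).
by rewrite !(nth_map (zero01 R)) // ltnW.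
Qed.

(** Neighbouring points are at distance between [minres] and [maxres]; summing up
    gives both bounds. *)
Lemma grid_dist n i k : (i + k <= N n)%N ->
  k%:R * minres X n <= \val (Defs.point X n (i + k)) - \val (Defs.point X n i)
    <= k%:R * maxres X n.
Proof.
elim: k => [|k IH] ikN; first by rewrite addn0 subrr !mul0r lexx.
have ikN' : (i + k < N n)%N by lia.
have /andP[IH1 IH2] := IH (ltnW ikN').
have hg : minres X n <= gap X n (i + k).
  by rewrite /minres (bigD1 (Ordinal ikN')) //= ge_min lexx.
have gH : gap X n (i + k) <= maxres X n.
  by rewrite /maxres (bigD1 (Ordinal ikN')) //= le_max lexx.
move: hg gH; rewrite gapE // addnS -natr1; nra.
Qed.

Lemma size_minres_le1 n : (N n)%:R * minres X n <= 1.
Proof.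
have /andP[+ _] := @grid_dist n 0 (N n) (leqnn _).
by rewrite add0n point_first point_last /= subr0.
Qed.

Lemma size_maxres_ge1 n : 1 <= (N n)%:R * maxres X n.
Proof.
have /andP[_] := @grid_dist n 0 (N n) (leqnn _).
by rewrite add0n point_first point_last /= subr0.
Qed.

Lemma minres_le_maxres n : minres X n <= maxres X n.
Proof.
have N0 : (0 < N n)%N by move: (gridsize_gt1 n); rewrite /N; lia.
have /andP[h H] := @grid_dist n 0 1 N0.
by move: (le_trans h H); rewrite !mul1r.
Qed.

Lemma index_point n i : (i <= N n)%N -> index (Defs.point X n i) (X n) = i.
Proof.
move=> iN; rewrite index_uniq //.
  by rewrite -/(gridsize X n); move: (gridsize_gt1 n) iN; rewrite /N; lia.
rewrite -(map_inj_uniq val_inj).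
by apply: sorted_uniq (grid_sorted dX n); [exact: lt_trans|exact: ltxx].
Qed.

Lemma index_grid n (x : I01 R) : x \in X n -> (index x (X n) <= N n)%N.
Proof. by rewrite -index_mem /N /gridsize; case: (size _). Qed.

Lemma size_quant f n : size (quant X f n) = N n.
Proof. by rewrite size_mkseq. Qed.

(** Codes are locally constant at functions whose grid values are centred in
    the cells of length [minres]. *)
Lemma quantE f n (L : nat -> int) :
  (forall i, (i <= N n)%N ->
     `|f (Defs.point X n i) - ((L i)%:~R + 1 / 2) * minres X n| < minres X n / 2) ->
  quant X f n = mkseq (fun i => L i.+1 - L i) (N n).
Proof.
move=> fL; have lev i : (i <= N n)%N -> level X f n i = L i.
  move=> iN; apply/(levelP _ _ _ _ dX); have := fL i iN.
  rewrite ltr_norml intrD => /andP[]; lra.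
rewrite /quant; apply/eq_in_map => i; rewrite mem_iota add0n => /andP[_ iN].
by rewrite !lev // ltnW.
Qed.

End Geometry.

(** Levels that follow the increments [P], except that at every multiple of [T] they
    jump back to the samples [t] measured in units of [h]. *)
Definition reset_level (R : realType) (P : nat -> int) T (t : nat -> R) (h : R) i : int :=
  Num.floor (t (i %/ T * T)%N / h) + \sum_(i %/ T * T <= k < i) P k.

Section ResetLevel.
Variables (R : realType) (P : nat -> int) (T : nat) (t : nat -> R) (h : R).
Hypothesis (T0 : (0 < T)%N) (h0 : 0 < h).
Let L := reset_level P T t h.

Lemma reset_levelS i : ~~ (T %| i.+1)%N -> L i.+1 - L i = P i.
Proof.
move=> Ti; rewrite /L /reset_level divnS // (negbTE Ti) add0n.
by rewrite big_nat_recr ?leq_divM //=; ring.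
Qed.

Lemma mismatches_reset N :
  (mismatches (mkseq (fun i => L i.+1 - L i)%R N) (mkseq P N) <= N %/ T)%N.
Proof.
rewrite /mismatches size_mkseq divn_count_dvd big_add1 /=.
rewrite big_nat [leqRHS]big_nat; apply: leq_sum => i /andP[_ iN].
rewrite !nth_mkseq //; case: (boolP (T %| _)%N) => [_|/reset_levelS ->].
  exact: leq_b1.
by rewrite eqxx.
Qed.

(** Three errors: rounding at the last reset, drift since then, and variation of [t]
    since then. *)
Lemma reset_level_dist (B : R) i : 0 <= B -> (forall i, `|(P i)%:~R| <= B) ->
  `|((L i)%:~R + 1 / 2) * h - t i|
     <= h + T%:R * B * h + `|t (i %/ T * T)%N - t i|.
Proof.
move=> B0 PB; set q := (i %/ T * T)%N.
pose S := \sum_(q <= k < i) P k.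
have SB : `|S%:~R| <= T%:R * B.
  rewrite /S raddf_sum /= (le_trans (ler_norm_sum _ _ _)) //.
  rewrite (le_trans (ler_sum _ (fun k _ => PB k))) //.
  rewrite sumr_const_nat -[B *+ _]mulr_natl ler_wpM2r // ler_nat.
  by rewrite {1}(divn_eq i T) addKn ltnW // ltn_pmod.
have /andP[f1 f2] : (Num.floor (t q / h))%:~R <= t q / h <
    (Num.floor (t q / h) + 1)%:~R by rewrite floor_le floorD1_gt.
move: f1 f2; rewrite ler_pdivlMr // ltr_pdivrMr // intrD => f1 f2.
have -> : ((L i)%:~R + 1 / 2) * h - t i =
    ((Num.floor (t q / h))%:~R * h + h / 2 - t q) + S%:~R * h + (t q - t i).
  by rewrite /L /reset_level -/q -/S intrD; lra.
rewrite (le_trans (ler_normD _ _)) // lerD2r (le_trans (ler_normD _ _)) // lerD //.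
  by rewrite ler_norml; apply/andP; split; lra.
by rewrite normrM [`|h|]gtr0_norm // ler_wpM2r // ltW.
Qed.

End ResetLevel.

(** * Continuous functions on the unit interval *)

Section Continuous.
Variable R : realType.
Implicit Types (f g : C01 R) (x y : I01 R).

Lemma C01_continuous_at f x (e : R) : 0 < e ->
  exists2 d : R, 0 < d &
    forall y, `|\val x - \val y| < d -> `|f x - f y| < e.
Proof.
move=> e0; have /cvgrPdist_lt/(_ e e0) := @cts_fun _ _ f x.
move=> /nbhs_ballP[d /= d0 xd]; exists d => // y xy; exact: xd.
Qed.

(** Heine's theorem, by compactness in the form of near coverings: near each point a
    single modulus serves, hence one serves everywhere. *)
Lemma C01_uniformly_continuous f (e : R) : 0 < e ->
  exists2 d : R, 0 < d &
    forall x y, `|\val x - \val y| < d -> `|f x - f y| < e.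
Proof.
move=> e0; pose P (d u : R) := forall x y, \val x = u ->
  `|\val x - \val y| < d -> `|f x - f y| < e.
have /compact_near_coveringP := @segment_compact R 0 1.
move=> /(_ R (0^'+) P (at_right_proper_filter 0)).
case.
- move=> u uI; pose x : I01 R := SigSub (mem_set uI).
  have [d d0 xd] := C01_continuous_at f x (divr_gt0 e0 (ltr0n _ 2)).
  exists ([set v | `|u - v| < d / 2], [set r | r < d / 2]) => /=.
    split; first by apply: (nbhsx_ballx u (d / 2)); rewrite divr_gt0.
    by apply: nbhs_right_lt; rewrite divr_gt0.
  move=> [v r] /= [uv rd] y z yv yz; rewrite -yv in uv.
  have xy := xd y _; have xz := xd z _.
  have : `|f x - f y| < e / 2 by apply: xy => /=; lra.
  have : `|f x - f z| < e / 2.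
    apply: xz => /=; rewrite (le_lt_trans (ler_distD (\val y) _ _)) //; lra.
  have := ler_distD (f x) (f y) (f z); rewrite [`|f y - f x|]distrC; lra.
- move=> d /= d0 dP; exists (d / 2); first by rewrite divr_gt0.
  move=> x y; have := dP (d / 2); apply => //.
  + by rewrite /ball /= sub0r normrN gtr0_norm ?ltr_pdivrMr ?ltr_pMr ?ltr1n ?divr_gt0.
  + by rewrite divr_gt0.
  + by apply/set_mem; exact: (valP x).
Qed.

Definition mkC01 (f : I01 R -> R) (cf : continuous f) : C01 R :=
  HB.pack f (isContinuous.Build _ _ f cf).

Lemma continuous_bigmax_point (I : Type) (s : seq I) (F : I -> I01 R -> R) (b : R) :
  (forall i, continuous (F i)) ->
  continuous (fun x => \big[Num.max/b]_(i <- s) F i x).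
Proof.
move=> cF; elim: s => [|i s IH] x.
  rewrite (_ : (fun x => _) = cst b); last by apply/funext => y; rewrite big_nil.
  exact: cst_continuous.
rewrite (_ : (fun x => _) = fun x => Num.max (F i x) (\big[Num.max/b]_(i <- s) F i x)).
  by apply: continuous_max; [exact: cF|exact: IH].
by apply/funext => y; rewrite big_cons.
Qed.

(** The slope [K] of the cones in [C01_prescribe]: steep enough that a cone centred at a point of
    [s] has dropped by [a] at every other point of [s]. *)
Lemma separating_factor (s : seq (I01 R)) (a : R) : 0 <= a ->
  exists2 K : R, 0 <= K &
    forall x y, x \in s -> y \in s -> x != y -> a <= K * `|\val x - \val y|.
Proof.
move=> a0; pose K := \sum_(x <- s) \sum_(y <- s) a / `|\val x - \val y|.
have t0 x y : 0 <= a / `|\val x - \val y| by rewrite divr_ge0.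
exists K; first by do 2 (apply: sumr_ge0 => ? _).
move=> x y xs ys xy; have xy0 : 0 < `|\val x - \val y|.
  by rewrite normr_gt0 subr_eq0; apply: contra xy => /eqP/val_inj ->.
rewrite -ler_pdivrMr //.
rewrite /K (big_rem x xs) /= ler_wpDr //.
  by apply: sumr_ge0 => ? _; apply: sumr_ge0 => ? _; exact: t0.
by rewrite (big_rem y ys) /= ler_wpDr //; apply: sumr_ge0 => ? _; exact: t0.
Qed.

(** A McShane extension of the corrections [v - g]: a supremum of steep cones centred
    at the points of [s], truncated from below at [- d]. *)
Lemma C01_prescribe g (s : seq (I01 R)) (v : I01 R -> R) (d : R) : 0 <= d ->
  (forall x, x \in s -> `|v x - g x| <= d) ->
  exists f, (forall x, x \in s -> f x = v x) /\ (forall x, `|f x - g x| <= d).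
Proof.
move=> d0 vg; have [K K0 sep] := separating_factor s (mulr_ge0 (ler0n R 2) d0).
pose F x y := v x - g x - K * `|\val x - \val y|.
pose c y := \big[Num.max/- d]_(x <- s) F x y.
have cF x : continuous (F x).
  move=> y; apply: (@continuous_comp _ _ _ (\val : I01 R -> R)
    (fun t => v x - g x - K * `|\val x - t|)); first exact: initial_continuous.
  apply: cvgB; first exact: cvg_cst.
  apply: cvgM; first exact: cvg_cst.
  by apply: cvg_norm; apply: cvgB; [exact: cvg_cst|exact: cvg_id].
have cfc : continuous (fun y => g y + c y).
  move=> y; apply: (@cvgD R R^o (I01 R) _ (nbhs_filter y) g c); first exact: cts_fun.
  exact: continuous_bigmax_point.
have c_ge x : - d <= c x by rewrite /c bigmax_ge_id.
have c_le y b : - d <= b -> (forall x, x \in s -> F x y <= b) -> c y <= b.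
  by move=> db Fb; rewrite /c big_seq; apply: bigmax_le.
exists (mkC01 cfc); split => [x xs|x] /=.
  apply/eqP; rewrite -subr_eq0; apply/eqP.
  have /andP[vd1 vd2] : - d <= v x - g x <= d by rewrite -ler_norml vg.
  suff -> : c x = v x - g x by lra.
  apply/eqP; rewrite eq_le; apply/andP; split.
    apply: c_le => // y ys; rewrite /F.
    have [->|yx] := eqVneq y x; first by rewrite subrr normr0; lra.
    have := sep y x ys xs yx.
    by have := vg y ys; rewrite ler_norml => /andP[]; lra.
  rewrite /c (le_trans _ (le_bigmax_seq (- d) x xpredT (fun y => F y x) xs isT)) //.
  by rewrite /F subrr normr0; lra.
rewrite addrAC subrr add0r ler_norml c_ge c_le //; first by lra.
move=> y ys; rewrite /F.
have := mulr_ge0 K0 (normr_ge0 (\val y - \val x)).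
by have := vg y ys; rewrite ler_norml => /andP[]; lra.
Qed.

End Continuous.

(** * Prescribing the frequency of a word *)

Section Density.
Variables (R : realType) (X : nat -> seq (I01 R)).
Hypothesis dX : discretization_system X.

Lemma pattern_le (w : seq int) j M i :
  `|(pattern w j M i)%:~R| <= 1 + \sum_(z <- w) `|z%:~R| :> R.
Proof.
have S0 : 0 <= \sum_(z <- w) `|z%:~R| :> R by apply: sumr_ge0.
rewrite /pattern /filler; case: ifP => _; last by case: all; rewrite ?normr0 ?normr1; lra.
have [wj|jw] := ltnP (i %% j) (size w); last by rewrite nth_default // normr0; lra.
rewrite (big_rem _ (mem_nth 0 wj)) /=.
have : 0 <= \sum_(z <- rem w`_(i %% j)%N w) `|z%:~R| :> R by apply: sumr_ge0.
by set S := \sum_(z <- _) _; set t := `|_|; lra.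
Qed.

Lemma map_sgz_pattern (w : seq int) j M N : {subset w <= [:: -1; 0; 1]} ->
  [seq sgz z | z <- mkseq (pattern w j M) N] = mkseq (pattern w j M) N.
Proof.
move=> sw; rewrite -map_comp; apply: eq_map => i /=; rewrite /pattern /filler.
case: ifP => _; last by case: all.
have [wj|jw] := ltnP (i %% j) (size w); last by rewrite nth_default.
by have := sw _ (mem_nth 0 wj); rewrite !inE => /or3P[] /eqP ->.
Qed.

Lemma mismatches_map (h : int -> int) (v v' : seq int) : size v = size v' ->
  (mismatches (map h v) (map h v') <= mismatches v v')%N.
Proof.
move=> vv'; rewrite /mismatches size_map big_nat [leqRHS]big_nat.
apply: leq_sum => i /andP[_ iv]; rewrite !(nth_map 0) -?vv' //.
by have [->|_] := eqVneq v`_i v'`_i; [rewrite eqxx|exact: leq_b1].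
Qed.

(** A proportion [1 / T] of altered letters costs [size w / T] in frequency, and a bounded
    defect in the number of occurrences is negligible for long words. *)
Lemma fr_near (w u v : seq int) (a : R) T :
  size u = size v -> (0 < size v)%N -> (0 < T)%N ->
  (mismatches u v <= size v %/ T)%N ->
  `|(oc w v)%:R - a * (size v)%:R| <= (2 * size w).+1%:R ->
  `|fr R w u - a| <= (size w)%:R / T%:R + (2 * size w).+1%:R / (size v)%:R.
Proof.
move=> uv v0 T0 muv ocv.
have v0R : 0 < (size v)%:R :> R by rewrite ltr0n.
have T0R : 0 < T%:R :> R by rewrite ltr0n.
have mR : (mismatches u v)%:R <= (size v)%:R / T%:R :> R.
  rewrite ler_pdivlMr // -natrM ler_nat.
  by rewrite (leq_trans _ (leq_divM (size v) T)) // leq_mul2r muv orbT.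
have ou : (oc w u)%:R <= (oc w v)%:R + (size w)%:R * (mismatches u v)%:R :> R.
  by rewrite -natrM -natrD ler_nat oc_mismatches.
have ov : (oc w v)%:R <= (oc w u)%:R + (size w)%:R * (mismatches u v)%:R :> R.
  by rewrite -natrM -natrD ler_nat mismatchesC // oc_mismatches.
have W0 : 0 <= (size w)%:R :> R by rewrite ler0n.
have Wm := ler_wpM2l W0 mR.
rewrite /fr uv -[a in X in X <= _](mulfK (lt0r_neq0 v0R)) -mulrBl normrM.
rewrite [`|_^-1|]gtr0_norm ?invr_gt0 // ler_pdivrMr //.
rewrite mulrDl divfK ?lt0r_neq0 // mulrAC -[X in _ <= X + _]mulrA.
move: ocv; rewrite !ler_norml => /andP[c1 c2]; apply/andP; split; lra.
Qed.

(** The code of [f] follows a [pattern], but is reset to [g] every [T] letters, which spoils a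
    proportion [1 / T] of the letters.  Since [T] is fixed before the scale [n],
    the drift between two resets, at most [T] times a letter times [minres], and the
    oscillation of [g] on intervals of length [T] times [maxres] are both small. *)
Lemma exists_code (g : C01 R) (w : seq int) (a e eps : R) (n0 : nat) :
  w <> [::] -> 0 <= a <= 1 / (period w)%:R -> 0 < e -> 0 < eps ->
  exists n (f : C01 R) (eta : R), [/\ (n0 <= n)%N, 0 < eta,
    forall x, `|f x - g x| <= e &
    forall f' : C01 R, (forall x, `|f x - f' x| < eta) ->
      `|fr R w (quant X f' n) - a| < eps /\
      ({subset w <= [:: -1; 0; 1]} -> `|fr R w (qual X f' n) - a| < eps)].
Proof.
move=> w0 /andP[a0 ap] e0 eps0.
have [j /andP[j0 jp] per] := self_overlap w.
set W := size w.
have [T T0 WT] : exists2 T, (0 < T)%N & W%:R / T%:R < eps / 2 :> R.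
  exists (Num.truncn (W%:R / (eps / 2))).+1 => //.
  rewrite ltr_pdivrMr ?ltr0n // mulrC -ltr_pdivrMr ?divr_gt0 //.
  exact: truncnS_gt.
pose B : R := 1 + \sum_(z <- w) `|z%:~R|.
have B0 : 0 <= B by rewrite addr_ge0 //; apply: sumr_ge0.
have e20 : 0 < e / 2 by rewrite divr_gt0.
have [d d0 gd] := C01_uniformly_continuous g e20.
pose K : R := (2 * W).+1%:R.
have K1 : 1 <= K by rewrite ler1n.
have TR : 0 < T%:R :> R by rewrite ltr0n.
have TB : 0 < 1 + T%:R * B by rewrite ltr_wpDr // mulr_ge0 // ltW.
(* A bound on maxres n: between two resets g moves little, the drift is small,
   and there are enough letters for the boundary terms to be negligible. *)
pose c := Num.min (d / T%:R) (Num.min (e / 2 / (1 + T%:R * B))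
  (Num.min K^-1 (eps / 2 / K))).
have K0 : 0 < K := lt_le_trans ltr01 K1.
have c0 : 0 < c by rewrite /c !lt_min invr_gt0 K0 !divr_gt0.
have [n n0n Hc] : exists2 n, (n0 <= n)%N & maxres X n < c.
  have /cvgrPdist_lt/(_ c c0) := grid_fine dX; case=> m _ mH.
  exists (maxn n0 m); first exact: leq_maxl.
  have := mH (maxn n0 m) (leq_maxr _ _).
  by rewrite sub0r normrN => /(le_lt_trans (ler_norm _)).
move: Hc; rewrite /c !lt_min => /and4P[Hd He HK Heps].
set H := maxres X n in Hd He HK Heps.
set h := minres X n.
have h0 : 0 < h := minres_gt0 n dX.
have hH : h <= H := minres_le_maxres dX n.
set N := (gridsize X n).-1.
have NH : 1 <= N%:R * H := size_maxres_ge1 dX n.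
have H0 : 0 < H := lt_le_trans h0 hH.
have KN : K < N%:R.
  rewrite -(ltr_pM2r H0) (lt_le_trans _ NH) //.
  by rewrite -(ltr_pM2l (x := K^-1)) ?invr_gt0 // mulrA mulVf ?gt_eqF // mul1r mulr1.
have WN : (W <= N)%N.
  move: KN; rewrite ltr_nat => /ltnW; apply: leq_trans.
  by rewrite mul2n -addnn -addnS leq_addr.
have N0 : 0 < N%:R :> R := lt_trans K0 KN.
have aN : 0 <= a * N%:R <= N%:R / j%:R.
  rewrite mulr_ge0 // mulrC ler_pM2l //= (le_trans ap) // mul1r.
  by rewrite lef_pV2 ?ler_nat // ?posrE ltr0n // (leq_trans j0).
have [M ocM] := exists_pattern w0 j0 WN per aN.
pose P := pattern w j M.
pose t i : R := g (Defs.point X n i).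
pose L := reset_level P T t h.
have tL i : (i <= N)%N -> `|((L i)%:~R + 1 / 2) * h - t i| <= e.
  move=> iN; apply: le_trans (reset_level_dist t T0 h0 i B0 (pattern_le w j M)) _.
  have qi : (i %/ T * T <= i)%N by exact: leq_divM.
  have : `|t (i %/ T * T)%N - t i| < e / 2.
    apply: gd; rewrite distrC.
    have iqN : (i %/ T * T + i %% T <= N)%N by rewrite -divn_eq.
    have /andP[l1 l2] := grid_dist dX iqN.
    rewrite -divn_eq in l1 l2.
    have iT : (i %% T)%:R <= T%:R :> R by rewrite ler_nat ltnW // ltn_pmod.
    rewrite ger0_norm; last by rewrite (le_trans _ l1) // mulr_ge0 // ltW.
    apply: (le_lt_trans l2); apply: (le_lt_trans (ler_wpM2r (ltW H0) iT)).
    by rewrite mulrC -ltr_pdivlMr.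
  have := ler_wpM2r (ltW TB) hH; move: He; rewrite ltr_pdivlMr //.
  by clear; lra.
pose v (x : I01 R) := ((L (index x (X n)))%:~R + 1 / 2) * h.
have vg x : x \in X n -> `|v x - g x| <= e.
  move=> xX; have := tL (index x (X n)); rewrite /v /t /Defs.point nth_index //.
  by apply; exact: index_grid.
have [f [fv fg]] := C01_prescribe (ltW e0) vg.
exists n, f, (h / 2); split => // [|f' ff']; first by rewrite divr_gt0.
have Qf' : quant X f' n = mkseq (fun i => L i.+1 - L i) N.
  apply: (quantE dX) => i iN; have := ff' (Defs.point X n i).
  by rewrite distrC (fv _ (mem_point dX iN)) /v index_point.
have szP : size (mkseq P N) = N by rewrite size_mkseq.
have fin u : size u = N -> (mismatches u (mkseq P N) <= N %/ T)%N ->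
    `|fr R w u - a| < eps.
  move=> szu mu; have := @fr_near w u (mkseq P N) a T.
  rewrite szP => /(_ szu) /(_ ltac:(by rewrite -(ltr0n R))) /(_ T0 mu ocM).
  move/le_lt_trans; apply.
  suff : K / N%:R <= eps / 2 by rewrite -/W -/K; lra.
  rewrite ler_pdivrMr // (le_trans (ler_peMr (ltW K0) NH)) //.
  rewrite mulrCA mulrC ler_pM2r // ltW // mulrC.
  by move: Heps; rewrite ltr_pdivlMr.
have mQ := mismatches_reset P t h T0 N.
split; first by apply: fin; rewrite Qf' ?size_mkseq.
move=> sw; apply: fin; rewrite /qual Qf' ?size_map ?size_iota //.
rewrite -[mkseq P N](map_sgz_pattern _ _ _ sw).
by apply: leq_trans (mismatches_map _ _) mQ; rewrite !size_mkseq.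
Qed.

End Density.

(** * Genericity *)

Section Baire.
Variable R : realType.
Implicit Types (f g : C01 R) (U : set (C01 R)).

Lemma nbhs_C01_ge f U : nbhs f U ->
  exists2 r : R, 0 < r & forall g, (forall x, `|f x - g x| <= r) -> U g.
Proof.
move=> /nbhs_C01P[e e0 eU]; exists (e / 2); first by rewrite divr_gt0.
move=> g fg; apply: eU; apply: (@le_lt_trans _ _ (e / 2)); last by lra.
apply: ge_sup; first by exists `|f (zero01 R) - g (zero01 R)|, (zero01 R).
by move=> _ [x _ <-].
Qed.

Lemma nbhs_C01_gt f (r : R) U : 0 < r ->
  (forall g, (forall x, `|f x - g x| < r) -> U g) -> nbhs f U.
Proof.
move=> r0 rU; rewrite -nbhs_entourageE.
exists [set fg : C01 R * C01 R | forall t, ball (fg.1 t) r (fg.2 t)].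
  exists [set fg | forall t : I01 R, ball (fg.1 t) r (fg.2 t)] => //.
  exists [set xy : R * R | ball xy.1 r xy.2] => //.
  by rewrite -entourage_ballE; exists r.
by move=> g /set_mem /= fg; apply: rU.
Qed.

Section NestedBalls.
Variables (u : nat -> C01 R) (r : nat -> R).
Hypothesis r_gt0 : forall n, 0 < r n.
Hypothesis r_half : forall n, r n.+1 <= r n / 2.
Hypothesis u_near : forall n x, `|u n x - u n.+1 x| <= r n / 2.

Let nested n k x : `|u n x - u (n + k)%N x| <= r n - r (n + k)%N.
Proof.
elim: k => [|k IH]; first by rewrite addn0 !subrr normr0.
rewrite addnS (le_trans (ler_distD (u (n + k)%N x) _ _)) //.
have := r_half (n + k); have := u_near (n + k) x; move: IH; lra.
Qed.

(* The intervals of centre u n x and radius r n are nested; their common point is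
   obtained as the supremum of their left ends. *)
Let lower x : set R := [set u n x - r n | n in setT].

Let u_lim x := sup (lower x).

Let lowerP n m x : u n x - r n <= u m x + r m.
Proof.
have := nested n (maxn n m - n) x; have := nested m (maxn n m - m) x.
rewrite !subnKC ?leq_maxl ?leq_maxr // !ler_norml.
by have := r_gt0 (maxn n m) => r0 /andP[a1 a2] /andP[b1 b2]; lra.
Qed.

Let u_lim_near n x : `|u n x - u_lim x| <= r n.
Proof.
rewrite ler_norml; apply/andP; split.
  suff : u_lim x <= u n x + r n by lra.
  apply: ge_sup; first by exists (u 0 x - r 0), 0%N.
  by move=> _ [m _ <-]; exact: lowerP.
suff : u n x - r n <= u_lim x by lra.
apply: ub_le_sup; last by exists n.
by exists (u 0 x + r 0) => _ [m _ <-]; exact: lowerP.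
Qed.

Let r_small (e : R) : 0 < e -> exists n, r n < e.
Proof.
move=> e0; have rn n : r n * n.+1%:R <= r 0.
  apply: (@le_trans _ _ (r n * (2 ^ n)%:R)).
    by apply: ler_wpM2l; [exact: ltW|rewrite ler_nat; exact: ltn_expl].
  elim: n => [|n IH]; first by rewrite mulr1.
  apply: le_trans IH; rewrite expnS natrM mulrA ler_wpM2r //.
  by have := r_half n; lra.
exists (Num.truncn (r 0 / e)); rewrite -(ltr_pM2r (ltr0Sn R (Num.truncn (r 0 / e)))).
by apply: (le_lt_trans (rn _)); rewrite -ltr_pdivrMl // mulrC truncnS_gt.
Qed.

Lemma nested_balls : exists g, forall n x, `|u n x - g x| <= r n.
Proof.
have cu : continuous u_lim.
  move=> x; apply/(@cvgrPdist_lt R R^o _ (nbhs x) (nbhs_filter x)) => e e0.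
  have [n rn] := r_small (divr_gt0 e0 (ltr0n R 3)).
  have [d d0 xd] := C01_continuous_at (u n) x (divr_gt0 e0 (ltr0n R 3)).
  apply/nbhs_ballP; exists d => //= y xy; have := xd y xy.
  move: (u_lim_near n x) (u_lim_near n y) rn.
  rewrite !ler_norml !ltr_norml => /andP[? ?] /andP[? ?] ? /andP[? ?].
  by apply/andP; split; lra.
by exists (mkC01 cu) => n x; exact: u_lim_near.
Qed.

End NestedBalls.

(** The usual nested closed balls, with radii at least halved at each step. *)
Lemma C01_baire (F : nat -> set (C01 R)) :
  (forall i, open (F i)) -> (forall i, dense (F i)) -> dense (\bigcap_i F i).
Proof.
move=> oF dF O [f0 Of0] oO.
have [r0 r00 r0O] := nbhs_C01_ge (open_nbhs_nbhs (conj oO Of0)).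
have step (p : nat * (C01 R * R)) : exists q : C01 R * R, 0 < p.2.2 ->
    [/\ 0 < q.2, q.2 <= p.2.2 / 2, forall x, `|p.2.1 x - q.1 x| <= p.2.2 / 2 &
      forall g, (forall x, `|q.1 x - g x| <= q.2) -> F p.1 g].
  case: p => i [f r] /=; have [r_gt0|] := ltP 0 r; last by exists (f, r).
  pose V : set (C01 R) := [set g | forall x, `|f x - g x| <= r / 2].
  have : V° !=set0.
    exists f; apply: (@nbhs_C01_gt f (r / 2)); first by rewrite divr_gt0.
    by move=> g fg x; exact: ltW.
  move=> /(dF i)/(_ (open_interior V)) [g [/interior_subset Vg Fg]].
  have [s s0 sF] := nbhs_C01_ge (open_nbhs_nbhs (conj (oF i) Fg)).
  exists (g, Num.min s (r / 2)) => _; split => //=.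
  - by rewrite lt_min s0 divr_gt0.
  - by rewrite ge_min lexx orbT.
  - by move=> k gk; apply: sF => x; rewrite (le_trans (gk x)) // ge_min lexx.
have [s sP] := choice step.
pose q := fix q n := if n is n'.+1 then s (n', q n') else (f0, r0).
have q0 n : 0 < (q n).2 by elim: n => //= n IH; case: (sP (n, q n) IH).
have qS n := sP (n, q n) (q0 n).
have [g qg] := nested_balls q0 (fun n => let: And4 _ h _ _ := qS n in h)
  (fun n => let: And4 _ _ h _ := qS n in h).
exists g; split; first by apply: r0O => x; exact: (qg 0%N).
by move=> i _; case: (qS i) => _ _ _; apply => x; exact: (qg i.+1).
Qed.

End Baire.

Section Generic.
Variables (R : realType) (X : nat -> seq (I01 R)).
Hypothesis dX : discretization_system X.

(** Equally spaced frequencies, a mesh of [0, 1 / period w] for 0 <= k <= m + 1. *)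
Definition target (w : seq int) k m : R := k%:R / m.+1%:R / (period w)%:R.

Definition near_target (w : seq int) k m : set (C01 R) := [set f |
  w <> [::] -> (k <= m.+1)%N -> exists n, [/\ (m <= n)%N,
    `|fr R w (quant X f n) - target w k m| < 1 / m.+1%:R &
    {subset w <= [:: -1; 0; 1]} ->
      `|fr R w (qual X f n) - target w k m| < 1 / m.+1%:R]].

Lemma period_gt0 (w : seq int) : (0 < period w)%N.
Proof. by have [j /andP[j0 jp] _] := self_overlap w; exact: leq_trans jp. Qed.

Lemma dense_near_target w k m : dense (near_target w k m)°.
Proof.
move=> O [g Og] oO.
have [r r0 rO] := nbhs_C01_ge (open_nbhs_nbhs (conj oO Og)).
case: (pselect (w <> [::] /\ (k <= m.+1)%N)) => [[w0 km]|nwk]; last first.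
  exists g; split => //; apply: (@nbhs_C01_gt _ g 1) => // f _ w0 km.
  by case: nwk.
have p0 : 0 < (period w)%:R :> R by rewrite ltr0n period_gt0.
have t01 : 0 <= target w k m <= 1 / (period w)%:R.
  rewrite /target !divr_ge0 // ler_pM2r ?invr_gt0 //.
  by rewrite ler_pdivrMr ?ltr0n // mul1r ler_nat.
have [//|n [f [eta [mn eta0 fg near_f]]]] :=
  exists_code dX g m w0 t01 r0 (_ : 0 < 1 / m.+1%:R).
exists f; split; first by apply: rO => x; rewrite distrC.
apply: (nbhs_C01_gt eta0) => f' /near_f[nQ nq] _ _.
by exists n.
Qed.

(** The frequencies [target w k m] are countable in number and dense in
    [0, 1 / period w], so one residual set serves all words and all real frequencies. *)
Lemma generic_codes : residual
  [set f : C01 R | forall w (a : R) m, w <> [::] -> 0 <= a <= 1 / (period w)%:R ->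
    exists n, [/\ (m <= n)%N, `|fr R w (quant X f n) - a| < 2 / m.+1%:R &
      {subset w <= [:: -1; 0; 1]} -> `|fr R w (qual X f n) - a| < 2 / m.+1%:R]].
Proof.
pose F (i : nat) : set (C01 R) :=
  if @unpickle (seq int * nat * nat)%type i is Some (w, k, m)
  then (near_target w k m)° else setT.
have oF i : open (F i).
  by rewrite /F; case: unpickle => [[[w k] m]|]; [exact: open_interior|exact: openT].
have dF i : dense (F i).
  rewrite /F; case: unpickle => [[[w k] m]|]; first exact: dense_near_target.
  by move=> O O0 _; rewrite setIT.
exists (\bigcap_i F i); first by split; [exists F|exact: C01_baire].
move=> f Ff w a m w0 /andP[a0 ap].
have p0 : 0 < (period w)%:R :> R by rewrite ltr0n period_gt0.
have p1 : 1 <= (period w)%:R :> R by rewrite ler1n period_gt0.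
have m0 : 0 < m.+1%:R :> R by rewrite ltr0n.
pose b := a * (period w)%:R * m.+1%:R.
have b0 : 0 <= b by rewrite /b !mulr_ge0 // ltW.
pose k := Num.truncn b.
have /andP[kb bk] : k%:R <= b < k.+1%:R by exact: truncn_itv.
have km : (k <= m.+1)%N.
  rewrite -(ler_nat R) (le_trans kb) // /b ger_pMl //.
  by rewrite -ler_pdivlMr.
have ta : `|target w k m - a| < 1 / m.+1%:R.
  have -> : target w k m - a = (k%:R - b) / ((period w)%:R * m.+1%:R).
    by rewrite /target /b; field; rewrite !gt_eqF.
  have pm0 : 0 < (period w)%:R * m.+1%:R :> R by rewrite mulr_gt0.
  rewrite normrM [`|_^-1|]gtr0_norm ?invr_gt0 //.
  have kb1 : `|k%:R - b| < 1.
    by move: bk; rewrite -natr1 ltr_norml => bk; apply/andP; split; lra.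
  rewrite ltr_pdivrMr // mul1r mulrCA mulVf ?gt_eqF // mulr1.
  exact: lt_le_trans p1.
have := Ff (pickle (w, k, m)) Logic.I; rewrite /F pickleK.
move=> /interior_subset/(_ w0 km)[n [mn nQ nq]].
have tri (c : R) : `|c - target w k m| < 1 / m.+1%:R -> `|c - a| < 2 / m.+1%:R.
  move=> ct; rewrite (le_lt_trans (ler_distD (target w k m) _ _)) //.
  by rewrite -[2]/(1 + 1) mulrDl ltrD.
by exists n; split => // [|/nq]; exact: tri.
Qed.

Lemma exists_subseq_cvg (u : nat -> R) (a : R) :
  (forall m, exists2 n, (m <= n)%N & `|u n - a| < 2 / m.+1%:R) ->
  exists2 phi : nat -> nat, increasing_seq phi & u (phi i) @[i --> \oo] --> a.
Proof.
move=> uP; have /choice[c cP] : forall m, exists n,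
    (m <= n)%N /\ `|u n - a| < 2 / m.+1%:R.
  by move=> m; have [n] := uP m; exists n.
pose phi := fix phi i := if i is i'.+1 then c (phi i').+1 else c 0%N.
have phiS i : (phi i < phi i.+1)%N by case: (cP (phi i).+1).
have iphi i : (i <= phi i)%N by elim: i => // i IH; exact: leq_ltn_trans (phiS i).
exists phi; first exact/increasing_seqP.
have phi_a i : `|u (phi i) - a| < 2 / i.+1%:R.
  case: i => [|i]; first by case: (cP 0%N).
  case: (cP (phi i).+1) => _ /lt_le_trans; apply.
  by rewrite ler_pM2l // lef_pV2 ?posrE ?ltr0n // ler_nat ltnS ltnS.
apply/cvgrPdist_lt => e e0; near=> i; rewrite distrC (lt_trans (phi_a i)) //.
rewrite ltr_pdivrMr ?ltr0n // mulrC -ltr_pdivrMr //.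
by rewrite (lt_trans (truncnS_gt _)) // ltr_nat ltnS; near: i; exact: nbhs_infty_gt.
Unshelve. all: by end_near. Qed.

End Generic.

(** * The stretched code *)

Lemma oc_letter (a : int) (s : seq int) : oc [:: a] s = count_mem a s.
Proof.
case: s => [//|b s]; rewrite ocE // subSS subn0 -sum1_count [RHS]big_mkcond.
rewrite [RHS](big_nth 0); apply: eq_bigr => i _ /=.
by rewrite addn0 andbT; case: (_ == a).
Qed.

Section StretchCount.
Implicit Types (z : int) (v : seq int).

Let str v := flatten [seq stretch z | z <- v].

Lemma count_stretch a z :
  count_mem a (stretch z) = ((sgz z == a)%R * `|z| + (0 == a)%R)%N.
Proof. by rewrite /stretch -cats1 count_cat count_nseq /= addn0. Qed.

Lemma count0_str v : count_mem 0 (str v) = size v.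
Proof.
elim: v => //= z v IH; rewrite count_cat IH count_stretch sgz_eq0 eqxx.
by case: eqP => [->|_]; rewrite ?mul0n ?muln0.
Qed.

Lemma size_str v : size (str v) = (\sum_(z <- v) (`|z| + 1))%N.
Proof.
elim: v => [|z v IH]; first by rewrite big_nil.
by rewrite /str /= size_cat big_cons -IH /stretch size_rcons size_nseq addn1.
Qed.

Lemma count_pm_str v :
  (count_mem 1%R (str v) + count_mem (-1)%R (str v) + size v = size (str v))%N
  /\ (count_mem 1 (str v))%:Z - (count_mem (-1) (str v))%:Z = \sum_(z <- v) z.
Proof.
elim: v => [|z v [IH1 IH2]] /=; first by rewrite big_nil.
rewrite /str /= !count_cat !count_stretch big_cons !size_cat -/(str v) -IH1 -IH2.
rewrite /stretch size_rcons size_nseq /=.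
by case: sgzP => z0 /=; lia.
Qed.

End StretchCount.

Section Variation.
Variables (R : realType) (X : nat -> seq (I01 R)).
Hypothesis dX : discretization_system X.
Variable f : C01 R.

Let N n := (gridsize X n).-1.
Let S n := size (stretched X f n).
Let h n := minres X n.
Let h0 n : 0 < h n := minres_gt0 n dX.

Definition grid_variation n : R :=
  \sum_(0 <= i < N n) `|f (Defs.point X n i.+1) - f (Defs.point X n i)|.

(** The grids are nested, and inserting points into a partition can only increase
    the variation, by the triangle inequality. *)
Lemma grid_variation_le m n : (m <= n)%N -> grid_variation m <= grid_variation n.
Proof.
suff step k : grid_variation k <= grid_variation k.+1.
  by move=> /subnKC <-; elim: (n - m)%N => [|k IH]; rewrite ?addn0 // addnS (le_trans IH).
pose F (x : R) := f (insubd (zero01 R) x).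
pose tl k := behead [seq \val x | x <- X k].
have XE j : [seq \val x | x <- X j] = 0 :: tl j.
  rewrite /tl; have := gridsize_gt1 dX j; have := grid_first dX j.
  by rewrite /gridsize; case: (X j) => //= x s -> _.
have part j : itv_partition 0 1 (tl j).
  split; first by have := grid_sorted dX j; rewrite XE.
  have -> : last 0 (tl j) = last (\val (zero01 R)) [seq \val x | x <- X j] by rewrite XE.
  by rewrite last_map (grid_last dX).
have varE j : grid_variation j = variation 0 1 F (tl j).
  rewrite /variation -XE /grid_variation.
  have -> : size (tl j) = N j.
    by rewrite /N /gridsize -(size_map \val) XE.
  rewrite big_nat [RHS]big_nat; apply: eq_bigr => i /andP[_ iN].
  have iX : (i.+1 < size (X j))%N by move: iN; rewrite /N /gridsize; case: (size _).
  by rewrite /F /= !(nth_map (zero01 R)) ?valKd // ltnW.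
have lt_tl j : sorted <%R (0 :: tl j) by have := grid_sorted dX j; rewrite XE.
rewrite !varE; apply: variation_subseq => //.
suff : subseq (0 :: tl k) (0 :: tl k.+1) by rewrite /= eqxx.
have sub x : x \in 0 :: tl k -> x \in 0 :: tl k.+1.
  rewrite -!XE => /mapP[y yk ->]; apply: map_f; exact: (grid_nested dX).
suff -> : 0 :: tl k = [seq x <- 0 :: tl k.+1 | x \in 0 :: tl k] by exact: filter_subseq.
apply: lt_sorted_eq => //; first exact/sorted_filter/lt_tl/lt_trans.
move=> x; rewrite mem_filter; case: (boolP (x \in 0 :: tl k)) => // /sub ->.
by [].
Qed.

Lemma level_itv n i :
  (level X f n i)%:~R * h n <= f (Defs.point X n i)
    < (level X f n i)%:~R * h n + h n.
Proof.
have := iffLR (levelP f n i _ dX) erefl.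
by rewrite intrD mulrDl mul1r.
Qed.

(** Rounding both endpoints changes an increment by less than one cell. *)
Lemma quant_dist n i : (i < N n)%N ->
  `| `|f (Defs.point X n i.+1) - f (Defs.point X n i)| -
     `|((quant X f n)`_i)%:~R| * h n| <= h n.
Proof.
move=> iN; rewrite nth_mkseq // -[X in _ * X](gtr0_norm (h0 n)) -normrM.
apply: le_trans (ler_dist_dist _ _) _; rewrite intrB.
have /andP[a1 a2] := level_itv n i.
have /andP[b1 b2] := level_itv n i.+1.
by rewrite ler_norml; apply/andP; split; lra.
Qed.

Lemma size_stretched n :
  (S n)%:R = \sum_(0 <= i < N n) (`|((quant X f n)`_i)%:~R| + 1) :> R.
Proof.
rewrite /S size_str (big_nth 0) natr_sum size_quant; apply: eq_bigr => i _.
by rewrite natrD -intr_norm natr_absz.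
Qed.

Lemma grid_variation_le_size n : grid_variation n <= (S n)%:R * h n.
Proof.
rewrite size_stretched mulr_suml /grid_variation big_nat [leRHS]big_nat.
apply: ler_sum => i /andP[_ /quant_dist]; rewrite ler_norml; lra.
Qed.

Lemma size_le_grid_variation n :
  (S n)%:R * h n <= grid_variation n + 2 * (N n)%:R * h n.
Proof.
have -> : 2 * (N n)%:R * h n = \sum_(0 <= i < N n) (2 * h n).
  by rewrite sumr_const_nat subn0 mulrAC -[RHS]mulr_natr.
rewrite size_stretched mulr_suml -big_split /= big_nat [leRHS]big_nat.
apply: ler_sum => i /andP[_ /quant_dist]; rewrite ler_norml; lra.
Qed.

Lemma sum_quant_dist n :
  `|(\sum_(z <- quant X f n) z)%:~R| * h n <= `|f (one01 R) - f (zero01 R)| + h n.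
Proof.
have -> : \sum_(z <- quant X f n) z = level X f n (N n) - level X f n 0.
  rewrite (big_nth 0) size_quant big_nat.
  under eq_bigr => i /andP[_ iN] do rewrite nth_mkseq //.
  by rewrite -big_nat telescope_sumr.
rewrite -[X in _ * X](gtr0_norm (h0 n)) -normrM.
have /andP[a1 a2] := level_itv n 0.
have /andP[b1 b2] := level_itv n (N n).
rewrite point_first // in a1 a2; rewrite point_last // in b1 b2.
rewrite (_ : _ * _ = (f (one01 R) - f (zero01 R)) - ((f (one01 R) - f (zero01 R)) -
   (level X f n (N n) - level X f n 0)%:~R * h n)); last by ring.
rewrite (le_trans (ler_normB _ _)) // lerD2l intrB.
by rewrite ler_norml; apply/andP; split; lra.
Qed.

End Variation.

Section StretchedLimits.
Variables (R : realType) (X : nat -> seq (I01 R)).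
Hypothesis dX : discretization_system X.
Variable f : C01 R.

Let N n := (gridsize X n).-1.
Let S n := size (stretched X f n).
Let h n := minres X n.
Let h0 n : 0 < h n := minres_gt0 n dX.

Let N0 n : 0 < (N n)%:R :> R.
Proof. by rewrite ltr0n /N; have := gridsize_gt1 dX n; case: gridsize => [|[]]. Qed.

Let S0 n : 0 < (S n)%:R :> R.
Proof.
apply: (lt_le_trans (N0 n)); rewrite ler_nat /S.
have <- : size (quant X f n) = N n := size_quant X f n.
by rewrite -[leqLHS]count0_str count_size.
Qed.

Hypothesis unbounded : forall c : R, exists n, c < grid_variation X f n.

(** The length of the stretched code times [minres] is at least the variation, which tends
    to infinity, so a count needs only be known up to a constant multiple of 1 / [minres]. *)
Lemma fr_stretched_cvg (c : nat -> nat) (l C : R) :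
  (forall n, `|(c n)%:R - l * (S n)%:R| * h n <= C) ->
  (c n)%:R / (S n)%:R @[n --> \oo] --> l.
Proof.
move=> cC; apply/cvgrPdist_lt => e e0.
have [m mC] := unbounded (Num.max 0 (C / e)).
move: mC; rewrite gt_max => /andP[V0 VC].
exists m => // n /= mn.
have Sh : C / e < (S n)%:R * h n.
  apply: (lt_le_trans VC); apply: le_trans (grid_variation_le_size dX f n).
  exact: grid_variation_le.
have -> : l - (c n)%:R / (S n)%:R = - ((c n)%:R - l * (S n)%:R) / (S n)%:R.
  by field; rewrite gt_eqF.
rewrite normrM normrN [`|_^-1|]gtr0_norm ?invr_gt0 // ltr_pdivrMr //.
rewrite -(ltr_pM2r (h0 n)) (le_lt_trans (cC n)) //.
by rewrite -mulrA mulrC -ltr_pdivrMr.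
Qed.

Let h_le1 n : h n <= 1.
Proof.
have := size_minres_le1 dX n; rewrite -/(N n) -/(h n).
have : 1 <= (N n)%:R :> R by rewrite ler1n -(ltr0n R).
by move=> N1; apply: le_trans; rewrite ler_peMl // ltW.
Qed.

Lemma fr0_stretched_cvg : fr R [:: 0] (stretched X f n) @[n --> \oo] --> (0 : R).
Proof.
rewrite /fr; under eq_fun do rewrite oc_letter.
apply: (@fr_stretched_cvg _ _ 1) => n.
rewrite mul0r subr0 normr_nat count0_str size_quant.
exact: size_minres_le1.
Qed.

Let A n := count_mem 1 (stretched X f n).
Let B n := count_mem (-1) (stretched X f n).

Let SE n : (S n)%:R = (A n)%:R + (B n)%:R + (N n)%:R :> R.
Proof.
have [+ _] := count_pm_str (quant X f n).
by rewrite size_quant -!natrD => ->.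
Qed.

Let AB_dist n : `|(A n)%:R - (B n)%:R| * h n <= `|f (one01 R) - f (zero01 R)| + 1.
Proof.
have [_ /(congr1 (fun z : int => z%:~R : R))] := count_pm_str (quant X f n).
rewrite intrB /= -/(A n) -/(B n) => ->.
by apply: le_trans (sum_quant_dist dX f n) _; rewrite lerD2l h_le1.
Qed.

Lemma half_dist (c b : R) n : c + b + (N n)%:R = (S n)%:R ->
  `|c - b| * h n <= `|f (one01 R) - f (zero01 R)| + 1 ->
  `|c - 1 / 2 * (S n)%:R| * h n <= `|f (one01 R) - f (zero01 R)| + 2.
Proof.
move=> <- cb; rewrite (_ : c - _ = ((c - b) - (N n)%:R) / 2); last by field.
rewrite normrM [`|2^-1|]gtr0_norm // mulrAC ler_pdivrMr //.
have := ler_wpM2r (ltW (h0 n)) (ler_normB (c - b) (N n)%:R).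
rewrite mulrDl [`|_%:R|]normr_nat.
have := size_minres_le1 dX n; rewrite -/(N n) -/(h n).
have := normr_ge0 (f (one01 R) - f (zero01 R)); lra.
Qed.

Lemma fr1_stretched_cvg : fr R [:: 1] (stretched X f n) @[n --> \oo] --> (1 / 2 : R).
Proof.
rewrite /fr; under eq_fun do rewrite oc_letter.
by apply: fr_stretched_cvg => n; apply: (half_dist (esym (SE n)) (AB_dist n)).
Qed.

Lemma frN1_stretched_cvg : fr R [:: -1] (stretched X f n) @[n --> \oo] --> (1 / 2 : R).
Proof.
rewrite /fr; under eq_fun do rewrite oc_letter.
apply: fr_stretched_cvg => n; apply: (@half_dist _ (A n)%:R).
  by rewrite SE [(A n)%:R + _]addrC.
by rewrite distrC.
Qed.

End StretchedLimits.

Lemma period_letter (a : int) : period [:: a] = 1%N.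
Proof.
apply/eqP; rewrite eqn_leq period_gt0 andbT.
by apply: (proj2 (periodP [:: a]) [:: a]); rewrite oc_letter /= eqxx.
Qed.

(** When the letter [k] fills more than half of the code, [f] climbs about [k] cells of
    length [minres] on more than half of the gaps.  The number of gaps being comparable
    to 1 / [minres], this is a total variation of order [k]. *)
Lemma grid_variation_unbounded (R : realType) (X : nat -> seq (I01 R)) (f : C01 R) :
  discretization_system X ->
  (forall k : nat, exists n, `|fr R [:: k%:Z] (quant X f n) - 1| < 1 / 2) ->
  (exists M : R, forall n, maxres X n / minres X n <= M) ->
  forall c : R, exists n, c < grid_variation X f n.
Proof.
move=> dX large [M HM] c; pose c1 := Num.max c 0.
pose k := (Num.truncn (2 * (c1 * M + 2))).+1.
have [n nk] := large k; exists n; apply: (@le_lt_trans _ _ c1); first by rewrite le_max lexx.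
have c10 : 0 <= c1 by rewrite le_max lexx orbT.
set N : R := (gridsize X n).-1%:R; set h := minres X n.
have h0 : 0 < h := minres_gt0 n dX.
have NMh : 1 <= N * (M * h).
  apply: le_trans (size_maxres_ge1 dX n) _; rewrite ler_wpM2l //.
  by rewrite -ler_pdivrMr.
have N0 : 0 < N.
  by rewrite ltr0n; have := gridsize_gt1 dX n; case: gridsize => [|[]].
have cN : N / 2 < (count_mem k%:Z (quant X f n))%:R.
  move: nk; rewrite /fr oc_letter size_quant -/N ltr_norml => /andP[+ _].
  by rewrite ltrBrDr ltr_pdivlMr //; set x := (count _ _)%:R; lra.
have kS : k%:R * (count_mem k%:Z (quant X f n))%:R <= (size (stretched X f n))%:R :> R.
  rewrite -natrM ler_nat size_str -sum1_count big_distrr big_mkcond /=.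
  by apply: leq_sum => z _; case: eqP => [->|_] //; rewrite muln1; exact: leq_addr.
have kc : 2 * (c1 * M + 2) < k%:R :> R by exact: truncnS_gt.
have k0 : 0 < k%:R :> R by rewrite ltr0n.
have := size_le_grid_variation dX f n; rewrite -/N -/h.
have : k%:R * (N / 2) * h < (size (stretched X f n))%:R * h.
  by rewrite ltr_pM2r // (lt_le_trans _ kS) // ltr_pM2l.
have Nh0 : 0 < N * h by rewrite mulr_gt0.
have := ler_wpM2l c10 NMh.
move: kc; rewrite -(ltr_pM2r Nh0).
clear; lra.
Qed.

Lemma cvg_limn_einf_esup (R : realType) (u : nat -> R) (l : R) :
  u n @[n --> \oo] --> l ->
  limn_einf (fun n => (u n)%:E) = l%:E /\ limn_esup (fun n => (u n)%:E) = l%:E.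
Proof.
move=> ul; have : (u n)%:E @[n --> \oo] --> l%:E.
  by apply: cvg_EFin; [exact: nearW|exact: ul].
by move=> /cvg_limn_einf_sup[-> ->].
Qed.

Theorem theorem1 (R : realType) (X : nat -> seq (I01 R))
    (dX : discretization_system X) :
  typical (fun f : C01 R =>
    [/\ forall (w : seq int) (alpha : R),
          w <> [::] -> {subset w <= [:: -1; 0; 1]} ->
          0 <= alpha <= 1 / (period w)%:R ->
          exists2 phi : nat -> nat, increasing_seq phi &
            fr R w (qual X f (phi i)) @[i --> \oo] --> alpha,
        limn_einf (fun n => (n.+1%:R * minres X n)%:E) = 0%E ->
        forall (w : seq int) (alpha : R),
          w <> [::] ->
          0 <= alpha <= 1 / (period w)%:R ->
          exists2 phi : nat -> nat, increasing_seq phi &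
            fr R w (quant X f (phi i)) @[i --> \oo] --> alpha
      & limn_einf (fun n => (n.+1%:R * minres X n)%:E) = 0%E ->
        (exists M : R, forall n, maxres X n / minres X n <= M) ->
        [/\ limn_einf (fun n => (fr R [:: 0] (stretched X f n))%:E) = 0%E,
            f (zero01 R) <= f (one01 R) ->
              limn_einf (fun n => (fr R [:: 1] (stretched X f n))%:E)
                = (1 / 2)%:E /\
              limn_esup (fun n => (fr R [:: -1] (stretched X f n))%:E)
                = (1 / 2)%:E
          & f (one01 R) <= f (zero01 R) ->
              limn_esup (fun n => (fr R [:: 1] (stretched X f n))%:E)
                = (1 / 2)%:E /\
              limn_einf (fun n => (fr R [:: -1] (stretched X f n))%:E)
                = (1 / 2)%:E]]).
Proof.
have [G GdG Gsub] := generic_codes dX; exists G => // f /Gsub near_f.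
split.
- move=> w alpha w0 sw alpha_le.
  apply: (exists_subseq_cvg (u := fun n => fr R w (qual X f n))) => m.
  by have [n [mn _ /(_ sw)]] := near_f w alpha m w0 alpha_le; exists n.
- move=> _ w alpha w0 alpha_le.
  apply: (exists_subseq_cvg (u := fun n => fr R w (quant X f n))) => m.
  by have [n [mn nQ _]] := near_f w alpha m w0 alpha_le; exists n.
- move=> _ bounded.
  have large (k : nat) : exists n, `|fr R [:: k%:Z] (quant X f n) - 1| < 1 / 2.
    have [//||n [_ nQ _]] := near_f [:: k%:Z] 1 3%N; last first.
      by exists n; apply: lt_le_trans nQ _; lra.
    by rewrite period_letter ler01 divr1 lexx.
  have unbounded := grid_variation_unbounded dX large bounded.
  have [z_inf _] := cvg_limn_einf_esup (fr0_stretched_cvg dX unbounded).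
  have [p_inf p_sup] := cvg_limn_einf_esup (fr1_stretched_cvg dX unbounded).
  have [m_inf m_sup] := cvg_limn_einf_esup (frN1_stretched_cvg dX unbounded).
  by split.
Qed.
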